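(* Let $h_1\in L^1(p)$ and $h_2\in L^2(p)$ be weakly differentiable functions on $]a,b[$ such that $h_1'<0$ and $h_2'<0$ almost everywhere. Then $$\operatorname*{ess\,inf}_{]a,b[}\left(-\frac{\widetilde{\mathcal{T}} h_2}{h_2'\,w}\right)\leq C(p,w)\leq \operatorname*{ess\,sup}_{]a,b[}\left(-\frac{\widetilde{\mathcal{T}} h_1}{h_1'\,w}\right).$$ Furthermore, if $-\widetilde{\mathcal{T}} h_2/(h_2'w)$ is (a.e.) constant on $]a,b[$, then $h_2$ saturates the weighted Poincaré inequality $\mathrm{PI}(p,w)$, i.e. $\mathrm{Var}_p[h_2]=C(p,w)\,\mathbb{E}_p[|h_2'|^2w]$.
   Context: Let $-\infty\le a<b\le\infty$ and let $p\in L^1(]a,b[)$ with $p>0$ a.e. and $\int_a^b p=1$ (a probability density on $]a,b[$). A weight is a function $w\in L^1_{\mathrm{loc}}(]a,b[)$ with $w>0$ a.e. and $pw\in L^1_{\mathrm{loc}}(]a,b[)$; fix such a weight $w$. Write $\mathbb{E}_p[f]=\int_a^b fp$ and $\mathrm{Var}_p$ for the corresponding variance. A function is weakly differentiable if it is locally absolutely continuous on $]a,b[$ (derivative $h'\in L^1_{\mathrm{loc}}$). Let $H^1(p,w)=\{h\in L^2(p): h \text{ weakly differentiable}, h'\in L^2(pw)\}$. The weighted Poincaré constant $C(p,w)\in[0,\infty]$ is the smallest constant $C$ such that $\mathrm{Var}_p[h]\le C\,\mathbb{E}_p[|h'|^2w]$ for all $h\in H^1(p,w)$. For $h\in L^1(p)$,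 define $\widetilde{\mathcal{T}} h(x)=\frac{1}{p(x)}\int_a^x (h-\mathbb{E}_p[h])\,p$. *)

(* Defs.v *)
From HB Require Import structures.
From mathcomp Require Import all_boot all_order all_algebra.
From mathcomp Require Import all_classical all_reals all_analysis.
Set Implicit Arguments. Unset Strict Implicit. Unset Printing Implicit Defensive.
Import Order.TTheory GRing.Theory Num.Theory.
Import numFieldNormedType.Exports.
Local Open Scope classical_set_scope.
Local Open Scope ring_scope.

Section Defs.
Variable R : realType.
Local Notation mu := (@lebesgue_measure R).

Definition oitv (a b : \bar R) : set R := [set x | (a < x%:E)%E /\ (x%:E < b)%E].

Definition locint (a b : \bar R) (f : R -> R) : Prop :=
  forall c d : R, (a < c%:E)%E -> (d%:E < b)%E ->
    mu.-integrable `[c, d] (EFin \o f).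

Definition is_density (a b : \bar R) (p : R -> R) : Prop :=
  [/\ mu.-integrable (oitv a b) (EFin \o p),
      {ae mu, forall x, oitv a b x -> 0 < p x} &
      (\int[mu]_(x in oitv a b) (p x)%:E = 1)%E].

Definition is_weight (a b : \bar R) (p w : R -> R) : Prop :=
  [/\ locint a b w, {ae mu, forall x, oitv a b x -> 0 < w x} &
      locint a b (fun x => p x * w x)].

(* h is weakly differentiable on ]a,b[ with weak derivative dh:
   h is locally absolutely continuous, i.e. dh in L^1_loc and
   h y - h x = \int_x^y dh for all x <= y in ]a,b[ *)
Definition weak_deriv (a b : \bar R) (h dh : R -> R) : Prop :=
  locint a b dh /\
  forall x y : R, oitv a b x -> oitv a b y -> x <= y ->
    h y - h x = Rintegral mu `[x, y] dh.

Definition inL1 (a b : \bar R) (p h : R -> R) : Prop :=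
  measurable_fun (oitv a b) h /\
  mu.-integrable (oitv a b) (fun x => (h x * p x)%:E).

Definition inL2 (a b : \bar R) (p h : R -> R) : Prop :=
  measurable_fun (oitv a b) h /\
  mu.-integrable (oitv a b) (fun x => (h x ^+ 2 * p x)%:E).

Definition Ep (a b : \bar R) (p h : R -> R) : R :=
  Rintegral mu (oitv a b) (fun x => h x * p x).

Definition Varp (a b : \bar R) (p h : R -> R) : \bar R :=
  (\int[mu]_(x in oitv a b) (((h x - Ep a b p h) ^+ 2) * p x)%:E)%E.

Definition energy (a b : \bar R) (p w dh : R -> R) : \bar R :=
  (\int[mu]_(x in oitv a b) ((dh x ^+ 2) * p x * w x)%:E)%E.

Definition inH1 (a b : \bar R) (p w h dh : R -> R) : Prop :=
  [/\ inL2 a b p h, weak_deriv a b h dh &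
      mu.-integrable (oitv a b) (fun x => ((dh x ^+ 2) * p x * w x)%:E)].

Definition poincare_const (a b : \bar R) (p w : R -> R) : \bar R :=
  ereal_inf [set C : \bar R | (0 <= C)%E /\
    forall h dh : R -> R, inH1 a b p w h dh ->
      (Varp a b p h <= C * energy a b p w dh)%E].

Definition Ttilde (a b : \bar R) (p h : R -> R) (x : R) : R :=
  (p x)^-1 * Rintegral mu [set y | (a < y%:E)%E /\ y < x]
                       (fun y => (h y - Ep a b p h) * p y).

(* essential supremum / infimum of F over ]a,b[ w.r.t. Lebesgue measure
   (the library's ess_sup/ess_inf, unfolded, for the measure restricted to ]a,b[) *)
Definition ess_sup_on (a b : \bar R) (F : R -> R) : \bar R :=
  ereal_inf [set y : \bar R | \forall x \ae mu, oitv a b x -> ((F x)%:E <= y)%E].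
Definition ess_inf_on (a b : \bar R) (F : R -> R) : \bar R :=
  ereal_sup [set y : \bar R | \forall x \ae mu, oitv a b x -> (y <= (F x)%:E)%E].

End Defs.

(* Main.v *)
(** Let h be decreasing with mean e, let m be a point where h m = e, and let G be
    the primitive of (h - e) p vanishing at a, so that the ratio in the theorem
    is G / (|h'| p w).  Since (h - e) p has total mass 0, Tonelli gives, for every
    q >= 0,
      \int |h(x) - e| p(x) |\int_m^x q| dx = \int q G.
    With q = |h'| the left side is Var h, hence Var h = \int |h'| G, which compares
    Var h with the energy of h and yields the lower bound and the equality case.
    For the upper bound take q = f'^2 / |h'| with f in H^1: by Cauchy-Schwarz,
    (f(x) - f(m))^2 <= |h(x) - e| |\int_m^x q|, so that
    Var f <= \int (f - f(m))^2 p <= \int f'^2 G / |h'|. *)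

Require Import Defs.
From HB Require Import structures.
From mathcomp Require Import all_boot all_order all_algebra.
From mathcomp Require Import all_classical all_reals all_analysis.
From mathcomp Require Import measurable_realfun.
From mathcomp Require Import ring lra.
Set Implicit Arguments. Unset Strict Implicit. Unset Printing Implicit Defensive.
Import Order.TTheory GRing.Theory Num.Theory.
Import numFieldNormedType.Exports.
Local Open Scope classical_set_scope.
Local Open Scope ring_scope.

(** * Almost-everywhere statements and integrable functions *)

Lemma lebesgue_aeS (R : realType) (P Q : R -> Prop) :
  (forall x, P x -> Q x) -> {ae (@lebesgue_measure R), forall x, P x} ->
  {ae (@lebesgue_measure R), forall x, Q x}.
Proof.
by apply: (@filterS _ _ (@ae_filter_ringOfSetsType _ _ _ (@lebesgue_measure R))).
Qed.

Lemma lebesgue_aeS2 (R : realType) (P Q S : R -> Prop) :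
  (forall x, P x -> Q x -> S x) ->
  {ae (@lebesgue_measure R), forall x, P x} ->
  {ae (@lebesgue_measure R), forall x, Q x} ->
  {ae (@lebesgue_measure R), forall x, S x}.
Proof.
by apply: (@filterS2 _ _ (@ae_filter_ringOfSetsType _ _ _ (@lebesgue_measure R))).
Qed.

Lemma integrable_EFinZl (R : realType) (D : set R) (c : R) (f : R -> R) :
  measurable D -> lebesgue_measure.-integrable D (EFin \o f) ->
  lebesgue_measure.-integrable D (EFin \o (fun x => c * f x)).
Proof.
move=> mD fi; have := integrableZl (mu := @lebesgue_measure R) mD c fi.
by apply: eq_integrable => // x _ /=; rewrite EFinM.
Qed.

Lemma integrable_EFinD (R : realType) (D : set R) (f g : R -> R) :
  measurable D -> lebesgue_measure.-integrable D (EFin \o f) ->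
  lebesgue_measure.-integrable D (EFin \o g) ->
  lebesgue_measure.-integrable D (EFin \o (fun x => f x + g x)).
Proof.
move=> mD fi gi; have := integrableD (mu := @lebesgue_measure R) mD fi gi.
by apply: eq_integrable => // x _ /=; rewrite EFinD.
Qed.

(** * The interval and its locally integrable functions *)

Lemma measurable_oitv (R : realType) (a b : \bar R) :
  measurable (oitv a b : set R).
Proof.
have -> : oitv a b = EFin @^-1` [set` `]a, b[ ].
  by apply/seteqP; split=> x /=; rewrite in_itv/= => /andP.
rewrite -[X in measurable X]setTI.
by apply: EFin_measurable => //; exact: emeasurable_itv.
Qed.

Lemma oitv_itvcc (R : realType) (a b : \bar R) (x y : R) :
  oitv a b x -> oitv a b y -> `[x, y] `<=` oitv a b.
Proof.
move=> [ax _] [_ yb] z /=; rewrite in_itv/= => /andP[xz zy]; split.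
- by rewrite (lt_le_trans ax)// lee_fin.
- by rewrite (le_lt_trans _ yb)// lee_fin.
Qed.

Lemma ex_fin_between_lower (R : realType) (a : \bar R) (x : R) :
  (a < x%:E)%E -> exists2 r : R, (a < r%:E)%E & r < x.
Proof.
case: a => [a||]//; last by move=> _; exists (x - 1); rewrite ?ltNyr//; lra.
by rewrite lte_fin => ax; exists ((a + x) / 2); rewrite ?lte_fin; lra.
Qed.

Lemma ex_fin_between_upper (R : realType) (b : \bar R) (x : R) :
  (x%:E < b)%E -> exists2 r : R, (r%:E < b)%E & x < r.
Proof.
case: b => [b||]//; last by move=> _; exists (x + 1); rewrite ?ltry//; lra.
by rewrite lte_fin => ax; exists ((b + x) / 2); rewrite ?lte_fin; lra.
Qed.

(** The open interval is a countable union of compact subintervals with rational endpoints, and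
    integrability on each of them includes measurability there. *)
Lemma locint_measurable (R : realType) (a b : \bar R) (f : R -> R) :
  locint a b f -> measurable_fun (oitv a b) f.
Proof.
move=> lf.
pose P (q : rat * rat) := (a < (ratr q.1 : R)%:E)%E && ((ratr q.2 : R)%:E < b)%E.
(* Enumerates the rational compact intervals through their codes; a number that codes no pair, or a
   pair that fails [P], contributes the empty set. *)
pose E n : set R := if (unpickle n : option (rat * rat)) is Some q then
  if P q then `[ratr q.1, ratr q.2]%classic else set0 else set0.
have mE n : measurable (E n).
  by rewrite /E; case: unpickle => // q; case: ifP.
have -> : oitv a b = \bigcup_n E n.
  apply/seteqP; split=> [x [ax xb]|x [n _]].
    have [r ar rx] := ex_fin_between_lower ax.
    have [s sb xs] := ex_fin_between_upper xb.
    have [q qrx] := rat_in_itvoo rx.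
    have [q' qrx'] := rat_in_itvoo xs.
    move: qrx qrx'; rewrite !in_itv/= => /andP[rq qx] /andP[xq' q's].
    exists (pickle (q, q')); [by []|rewrite /E pickleK /P/=].
    rewrite (lt_trans ar) ?lte_fin//= (lt_trans _ sb) ?lte_fin//=.
    by rewrite in_itv/= !ltW.
  rewrite /E; case: unpickle => //= q; case: ifP => // /andP[aq qb].
  rewrite /= in_itv/= => /andP[qx xq]; split.
  - by rewrite (lt_le_trans aq)// lee_fin.
  - by rewrite (le_lt_trans _ qb)// lee_fin.
apply/measurable_fun_bigcup => // n; rewrite /E.
case: unpickle => [q|]; last exact: measurable_fun_set0.
case: ifP => [/andP[aq qb]|_]; last exact: measurable_fun_set0.
apply/measurable_EFinP.
exact: (measurable_int lebesgue_measure (lf _ _ aq qb)).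
Qed.

(** The inverse is the power of exponent -1, a measurable function; on nonnegative numbers the two
    agree even at 0, where both take the value 0. *)
Lemma measurable_funVnorm (R : realType) (D : set R) (f : R -> R) :
  measurable_fun D f -> measurable_fun D (fun x => `|f x|^-1).
Proof.
move=> mf.
have -> : (fun x => `|f x|^-1) = (@powR R ^~ (-1)) \o (Num.norm \o f).
  by apply/funext => x /=; rewrite powR_inv1.
apply: (measurableT_comp (measurable_powR _)) => //.
exact: measurableT_comp.
Qed.

(** * Tonelli over the region between a fixed and a moving point *)

(** An unoriented interval: integrals over it carry no sign, so both sides of [m] are treated at
    once. As a condition on the pair [(x, u)] it is jointly measurable, and it can be sliced in
    either variable. *)
Definition between (R : realType) (m x : R) : set R :=
  [set u | (m < u <= x) || (x < u <= m)].

Lemma betweenE (R : realType) (m x : R) :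
  between m x = if m <= x then `]m, x]%classic else `]x, m]%classic.
Proof.
apply/seteqP; case: leP => mx; split=> u /=; rewrite in_itv/=.
- by case/orP => // /andP[? ?]; lra.
- by move=> H; apply/orP; left.
- by case/orP => // /andP[? ?]; lra.
- by move=> H; apply/orP; right.
Qed.

Lemma measurable_between_set (R : realType) (m : R) :
  measurable [set z : R * R | between m z.1 z.2].
Proof.
rewrite -[X in measurable X]setTI.
have : measurable_fun setT
    (fun z : R * R => (m < z.2 <= z.1) || (z.1 < z.2 <= m)).
  by apply: measurable_or; apply: measurable_and;
    (apply: measurable_fun_ltr || apply: measurable_fun_ler).
by move=> /(_ measurableT [set true]); exact.
Qed.

Lemma measurable_between (R : realType) (m x : R) :
  measurable (between m x : set R).
Proof. by rewrite betweenE; case: ifP. Qed.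

Lemma measurable_between_inv (R : realType) (m u : R) :
  measurable ([set x | between m x u] : set R).
Proof.
have -> : [set x | between m x u] = ysection [set z | between m z.1 z.2] u.
  by apply/seteqP; split=> x; rewrite /ysection/= inE.
by apply: measurable_ysection; exact: measurable_between_set.
Qed.

(** The integrand on the plane whose two iterated integrals are the sides of [tonelli_between]. *)
Definition between_kernel (R : realType) (m : R) (f q : R -> \bar R)
    (z : R * R) : \bar R :=
  (f z.1 * q z.2 * (\1_[set z | between m z.1 z.2] z)%:E)%E.

Section between_kernel.
Context (R : realType) (m : R) (f q : R -> \bar R).
Hypotheses (mf : measurable_fun setT f) (mq : measurable_fun setT q).
Hypotheses (f0 : forall x, (0 <= f x)%E) (q0 : forall x, (0 <= q x)%E).
Local Notation F := (between_kernel m f q).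

Lemma between_kernel_ge0 z : (0 <= F z)%E.
Proof. by rewrite /between_kernel !mule_ge0// lee_fin. Qed.

Lemma measurable_between_kernel : measurable_fun setT F.
Proof.
apply: emeasurable_funM.
  by apply: emeasurable_funM; exact: measurableT_comp.
by apply/measurable_EFinP; apply: measurable_indic; exact: measurable_between_set.
Qed.

Lemma integral_between_kernel1 x :
  (\int[lebesgue_measure]_u F (x, u) =
   f x * \int[lebesgue_measure]_(u in between m x) q u)%E.
Proof.
rewrite [in RHS]integral_mkcond -ge0_integralZl//.
- apply: eq_integral => u _; rewrite /between_kernel /patch indicE/=.
  rewrite (_ : ((x, u) \in _) = (u \in between m x)); last first.
    by apply/idP/idP => /set_mem H; apply/mem_set.
  by case: ifP; rewrite ?mule1 ?mule0.
- apply/measurable_restrict => //; first exact: measurable_between.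
  by rewrite setTI; apply: measurable_funS mq.
- by move=> u _; exact: erestrict_ge0.
Qed.

Lemma integral_between_kernel2 u :
  (\int[lebesgue_measure]_x F (x, u) =
   q u * \int[lebesgue_measure]_(x in [set x | between m x u]) f x)%E.
Proof.
rewrite [in RHS]integral_mkcond -ge0_integralZl//.
- apply: eq_integral => x _; rewrite /between_kernel /patch indicE/=.
  rewrite (_ : ((x, u) \in _) = (x \in [set x | between m x u])); last first.
    by apply/idP/idP => /set_mem H; apply/mem_set.
  by case: ifP; rewrite ?mule1 ?mule0// muleC.
- apply/measurable_restrict => //; first exact: measurable_between_inv.
  by rewrite setTI; apply: measurable_funS mf.
- by move=> x _; exact: erestrict_ge0.
Qed.

Lemma tonelli_between :
  (\int[lebesgue_measure]_x (f x * \int[lebesgue_measure]_(u in between m x) q u)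
   = \int[lebesgue_measure]_u
       (q u * \int[lebesgue_measure]_(x in [set x | between m x u]) f x))%E.
Proof.
transitivity (\int[lebesgue_measure]_x \int[lebesgue_measure]_u F (x, u))%E.
  by apply: eq_integral => x _; rewrite integral_between_kernel1.
rewrite fubini_tonelli; first last.
- exact: between_kernel_ge0.
- exact: measurable_between_kernel.
by apply: eq_integral => u _; rewrite integral_between_kernel2.
Qed.

(** The function is a partial integral of a nonnegative jointly measurable kernel, hence measurable
    by the Tonelli theorem; the next lemma is the same for the other variable. *)
Lemma measurable_mul_integral_between : measurable_fun setT
  (fun x => f x * \int[lebesgue_measure]_(u in between m x) q u)%E.
Proof.
under eq_fun do rewrite -integral_between_kernel1.
apply: (@measurable_fun_fubini_tonelli_F _ _ _ _ _ lebesgue_measure) => //.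
- exact: measurable_between_kernel.
- exact: between_kernel_ge0.
Qed.

Lemma measurable_mul_integral_between_inv : measurable_fun setT
  (fun u => q u * \int[lebesgue_measure]_(x in [set x | between m x u]) f x)%E.
Proof.
under eq_fun do rewrite -integral_between_kernel2.
apply: (@measurable_fun_fubini_tonelli_G _ _ _ _ _ lebesgue_measure) => //.
- exact: measurable_between_kernel.
- exact: between_kernel_ge0.
Qed.

End between_kernel.

(** * Increments of weakly differentiable functions *)

Lemma between_oitv (R : realType) (a b : \bar R) (m x : R) :
  oitv a b m -> oitv a b x -> between m x `<=` oitv a b.
Proof.
move=> Im Ix; rewrite betweenE; case: ifP => _;
  apply: (subset_trans (@subset_itv_oc_cc _ _ _ _)); exact: oitv_itvcc.
Qed.

Lemma ae_eq_oppr_norm (R : realType) (D : set R) (f : R -> R) :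
  {ae (@lebesgue_measure R), forall x, D x -> f x < 0} ->
  ae_eq lebesgue_measure D (EFin \o f) (fun x => - `|f x|%:E)%E.
Proof.
move=> f0; apply: lebesgue_aeS f0 => x fx Dx.
by rewrite /= ltr0_norm ?fx// opprK.
Qed.

Lemma integral_ae_lt0 (R : realType) (D : set R) (f : R -> R) :
  measurable D -> measurable_fun D f ->
  {ae (@lebesgue_measure R), forall x, D x -> f x < 0} ->
  (\int[lebesgue_measure]_(x in D) (f x)%:E =
   - \int[lebesgue_measure]_(x in D) `|f x|%:E)%E.
Proof.
move=> mD mf /ae_eq_oppr_norm/ae_eq_integral -> //.
- by rewrite integral_ge0N.
- exact/measurable_EFinP.
- apply: measurableT_comp => //; apply/measurable_EFinP.
  exact: measurableT_comp.
Qed.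

(** Absolute values remove the orientation, so one formula covers both positions of [x] relative to
    [m]. Passing from closed to half-open intervals drops a null point. *)
Lemma weak_deriv_integral_between (R : realType) (a b : \bar R)
    (h dh : R -> R) (m x : R) :
  weak_deriv a b h dh -> oitv a b m -> oitv a b x ->
  (`|h x - h m|%:E =
   `|\int[lebesgue_measure]_(u in between m x) (dh u)%:E|)%E.
Proof.
move=> [ldh hdh] Im Ix.
have itv y z : oitv a b y -> oitv a b z -> y <= z -> (`|h z - h y|%:E =
    `|\int[lebesgue_measure]_(u in `]y, z]) (dh u)%:E|)%E.
  move=> Iy Iz yz; rewrite hdh// EFin_normr_Rintegral//; last first.
    by apply: ldh; [case: Iy|case: Iz].
  rewrite integral_itv_obnd_cbnd//.
  have oc_cc : `]y, z] `<=` `[y, z] by exact: subset_itv_oc_cc.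
  apply: (measurable_funS _ oc_cc) => //.
  exact: (measurable_int lebesgue_measure (ldh _ _ Iy.1 Iz.2)).
rewrite betweenE; case: leP => [mx|/ltW xm]; first exact: itv.
by rewrite distrC; exact: itv.
Qed.

Lemma weak_deriv_measurable (R : realType) (a b : \bar R) (h dh : R -> R) :
  weak_deriv a b h dh -> measurable_fun (oitv a b) dh.
Proof. by case=> /locint_measurable. Qed.

Lemma weak_deriv_measurable_between (R : realType) (a b : \bar R)
    (h dh : R -> R) (m x : R) :
  weak_deriv a b h dh -> oitv a b m -> oitv a b x ->
  measurable_fun (between m x) dh.
Proof.
move=> wh Im Ix; apply: measurable_funS (weak_deriv_measurable wh).
  exact: measurable_oitv.
exact: between_oitv.
Qed.

Lemma weak_deriv_dist_le (R : realType) (a b : \bar R)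
    (h dh : R -> R) (m x : R) :
  weak_deriv a b h dh -> oitv a b m -> oitv a b x ->
  (`|h x - h m|%:E <=
   \int[lebesgue_measure]_(u in between m x) `|dh u|%:E)%E.
Proof.
move=> wh Im Ix; rewrite (weak_deriv_integral_between wh)//.
apply: le_abse_integral; first exact: measurable_between.
by apply/measurable_EFinP; exact: (weak_deriv_measurable_between wh).
Qed.

(** A derivative of constant sign produces no cancellation, so the bound of [weak_deriv_dist_le]
    becomes an equality. *)
Lemma weak_deriv_lt0_dist (R : realType) (a b : \bar R)
    (h dh : R -> R) (m x : R) :
  weak_deriv a b h dh ->
  {ae (@lebesgue_measure R), forall x, oitv a b x -> dh x < 0} ->
  oitv a b m -> oitv a b x ->
  (`|h x - h m|%:E =
   \int[lebesgue_measure]_(u in between m x) `|dh u|%:E)%E.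
Proof.
move=> wh dh0 Im Ix; rewrite (weak_deriv_integral_between wh)//.
rewrite integral_ae_lt0.
- by rewrite abseN gee0_abs// integral_ge0.
- exact: measurable_between.
- exact: (weak_deriv_measurable_between wh).
- by apply: lebesgue_aeS dh0 => u /[swap] /(between_oitv Im Ix) /[swap]; exact.
Qed.

Lemma weak_deriv_lt0_nincr (R : realType) (a b : \bar R)
    (h dh : R -> R) (x y : R) :
  weak_deriv a b h dh ->
  {ae (@lebesgue_measure R), forall x, oitv a b x -> dh x < 0} ->
  oitv a b x -> oitv a b y -> x <= y -> h y <= h x.
Proof.
move=> wh dh0 Ix Iy xy; rewrite -subr_le0 wh.2// fine_le0//.
rewrite integral_ae_lt0//.
- by rewrite oppe_le0 integral_ge0.
- apply: measurable_funS (weak_deriv_measurable wh).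
    exact: measurable_oitv.
  exact: oitv_itvcc.
- by apply: lebesgue_aeS dh0 => u /[swap] /(oitv_itvcc Ix Iy) /[swap]; exact.
Qed.

(** On a compact subinterval [h] is a constant plus the indefinite integral of [dh]. Continuity
    serves the intermediate value theorem in [ex_eq_mean]. *)
Lemma weak_deriv_continuous (R : realType) (a b : \bar R)
    (h dh : R -> R) (x y : R) :
  weak_deriv a b h dh -> oitv a b x -> oitv a b y -> x <= y ->
  {within `[x, y], continuous h}.
Proof.
move=> [ldh hdh] Ix Iy xy.
have idh : lebesgue_measure.-integrable `[x, y] (EFin \o dh).
  by apply: ldh; [case: Ix|case: Iy].
apply: (@subspace_eq_continuous _ _ _
    (fun z => h x + parameterized_integral lebesgue_measure x z dh)).
  move=> z; rewrite inE/= => /[dup] xyz; rewrite in_itv/= => /andP[xz zy].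
  rewrite /parameterized_integral -hdh//; first by rewrite addrC subrK.
  exact: (oitv_itvcc Ix Iy).
move=> z; apply: cvgD; first exact: cvg_cst.
exact: (parameterized_integral_continuous _ idh).
Qed.

(** * Moments with respect to the density *)

(** Since [p] has finite mass, it is enough that [|h| <= 1 + h ^+ 2], which follows from the square
    of [|h| - 1] being nonnegative. *)
Lemma inL2_inL1 (R : realType) (a b : \bar R) (p h : R -> R) :
  is_density a b p -> inL2 a b p h -> inL1 a b p h.
Proof.
move=> [ip _ _] [mh ih2]; split => //.
have mI := measurable_oitv a b.
have mp : measurable_fun (oitv a b) p.
  by apply/measurable_EFinP; exact: (measurable_int lebesgue_measure ip).
have := integrable_EFinD mI (integrable_norm ip) (integrable_norm ih2).
apply: le_integrable => //.
  by apply/measurable_EFinP; exact: measurable_funM.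
move=> x _ /=; rewrite lee_fin !normrM.
rewrite [leRHS]ger0_norm ?addr_ge0 ?mulr_ge0//.
rewrite -[X in X + _]mul1r -mulrDl ler_wpM2r//.
by have := sqr_ge0 (`|h x| - 1); have := normr_ge0 (h x); nra.
Qed.

Lemma integrable_subM (R : realType) (a b : \bar R) (p h : R -> R) (c : R) :
  is_density a b p -> inL1 a b p h ->
  lebesgue_measure.-integrable (oitv a b) (fun x => ((h x - c) * p x)%:E).
Proof.
move=> [ip _ _] [_ ih]; have mI := measurable_oitv a b.
have := integrable_EFinD mI ih (integrable_EFinZl (- c) mI ip).
by apply: eq_integrable => // x _ /=; rewrite mulrBl mulNr.
Qed.

Lemma Rintegral_density (R : realType) (a b : \bar R) (p : R -> R) :
  is_density a b p -> Rintegral lebesgue_measure (oitv a b) p = 1.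
Proof. by case=> _ _ p1; rewrite /Rintegral p1. Qed.

Lemma Rintegral_centered (R : realType) (a b : \bar R) (p h : R -> R) :
  is_density a b p -> inL1 a b p h ->
  Rintegral lebesgue_measure (oitv a b) (fun x => (h x - Ep a b p h) * p x) = 0.
Proof.
move=> dp [mh ih]; have mI := measurable_oitv a b; have [ip _ _] := dp.
under eq_Rintegral do rewrite mulrBl.
rewrite RintegralB//; last exact: (integrable_EFinZl _ mI ip).
by rewrite RintegralZl// (Rintegral_density dp) mulr1 subrr.
Qed.

Lemma integrable_sqr_subM (R : realType) (a b : \bar R) (p h : R -> R) (c : R) :
  is_density a b p -> inL2 a b p h ->
  lebesgue_measure.-integrable (oitv a b) (fun x => ((h x - c) ^+ 2 * p x)%:E).
Proof.
move=> dp /[dup] /(inL2_inL1 dp) h1 [mh ih2].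
have mI := measurable_oitv a b; have [ip _ _] := dp.
have := integrable_EFinD mI
  (integrable_EFinD mI ih2 (integrable_EFinZl (-2 * c) mI h1.2))
  (integrable_EFinZl (c ^+ 2) mI ip).
by apply: eq_integrable => // x _ /=; congr EFin; ring.
Qed.

(** Expanding around the mean [e], the cross term integrates to 0, so the right side exceeds the
    variance by [(e - c) ^+ 2]. *)
Lemma Varp_le (R : realType) (a b : \bar R) (p h : R -> R) (c : R) :
  is_density a b p -> inL2 a b p h ->
  (Varp a b p h <=
   \int[lebesgue_measure]_(x in oitv a b) ((h x - c) ^+ 2 * p x)%:E)%E.
Proof.
move=> dp h2; have h1 := inL2_inL1 dp h2; have [ip _ _] := dp.
have mI := measurable_oitv a b; set e := Ep a b p h.
rewrite /Varp -/e -[leLHS]fineK; last first.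
  exact/integrable_fin_num/integrable_sqr_subM.
rewrite -[leRHS]fineK; last exact/integrable_fin_num/integrable_sqr_subM.
rewrite lee_fin.
have -> : fine (\int[lebesgue_measure]_(x in oitv a b) ((h x - c) ^+ 2 * p x)%:E)%E
    = Rintegral lebesgue_measure (oitv a b)
        (fun x => (h x - e) ^+ 2 * p x + 2 * (e - c) * ((h x - e) * p x)
                  + (e - c) ^+ 2 * p x).
  by apply: eq_Rintegral => x _; ring.
have i2 := integrable_sqr_subM e dp h2.
have i1 := integrable_subM e dp h1.
rewrite RintegralD//; last 2 first.
- exact: (integrable_EFinD mI i2 (integrable_EFinZl (2 * (e - c)) mI i1)).
- exact: (integrable_EFinZl _ mI ip).
rewrite RintegralD//; last exact: (integrable_EFinZl _ mI i1).
rewrite !RintegralZl// (Rintegral_density dp) Rintegral_centered//.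
by rewrite mulr0 addr0 mulr1 lerDl sqr_ge0.
Qed.

(** * Existence of a point where the mean is attained *)

(** The interval carries mass 1, so it is not a null set. Contradictory almost-everywhere facts are
    refuted through this lemma. *)
Lemma density_not_ae_false (R : realType) (a b : \bar R) (p : R -> R) :
  is_density a b p ->
  ~ {ae (@lebesgue_measure R), forall x, oitv a b x -> False}.
Proof.
move=> [ip _ p1] aeF; have mI := measurable_oitv a b.
have : (\int[lebesgue_measure]_(x in oitv a b) (p x)%:E = 0)%E.
  rewrite (ae_eq_integral (cst 0%E))// ?integral0//.
  - exact: (measurable_int lebesgue_measure).
  - by apply: lebesgue_aeS aeF => x /[apply].
by rewrite p1 => -[] /eqP; rewrite oner_eq0.
Qed.

Lemma ae_pos_Rintegral_neq0 (R : realType) (a b : \bar R) (p f : R -> R) :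
  is_density a b p -> lebesgue_measure.-integrable (oitv a b) (EFin \o f) ->
  {ae (@lebesgue_measure R), forall x, oitv a b x -> 0 < f x} ->
  Rintegral lebesgue_measure (oitv a b) f != 0.
Proof.
move=> dp ifI f0; apply/eqP => f00; have mI := measurable_oitv a b.
apply: (density_not_ae_false dp).
have mf : measurable_fun (oitv a b) (EFin \o f).
  exact: (measurable_int lebesgue_measure).
have : ae_eq lebesgue_measure (oitv a b) (EFin \o f) (cst 0%E).
  apply/(ae_eq_integral_abs lebesgue_measure mI mf).
  transitivity (\int[lebesgue_measure]_(x in oitv a b) (f x)%:E)%E.
    apply/esym/ae_eq_integral => //; first exact: measurableT_comp.
    apply: lebesgue_aeS f0 => x /[swap] Ix /(_ Ix) fx /=.
    by rewrite gtr0_norm.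
  by rewrite -[LHS]fineK ?integrable_fin_num// -/(Rintegral _ _ _) f00.
apply: lebesgue_aeS2 f0 => x fx0 fx Ix.
by move: (fx0 Ix) (fx Ix) => /= /[swap] -[->]; rewrite ltxx.
Qed.

(** Otherwise, by continuity, [h] would stay strictly on one side of its mean [e]; then [(h - e) p]
    would have constant sign almost everywhere and could not integrate to 0. *)
Lemma ex_eq_mean (R : realType) (a b : \bar R) (p h dh : R -> R) :
  is_density a b p -> inL1 a b p h -> weak_deriv a b h dh ->
  exists2 m, oitv a b m & h m = Ep a b p h.
Proof.
move=> dp h1 wh; apply: contrapT => nex; set e := Ep a b p h in nex *.
have hne x : oitv a b x -> h x != e.
  by move=> Ix; apply/eqP => hx; apply: nex; exists x.
(* Values on both sides of [e] would force the value [e] in between; the two orders of [x] and [y]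
   are treated separately. *)
have crossing x y : oitv a b x -> oitv a b y -> h x < e -> e < h y -> False.
  move=> Ix Iy hx hy; have [xy|/ltW yx] := leP x y.
    have [|c cxy hc] := IVT xy (weak_deriv_continuous wh Ix Iy xy) (v := e).
      by rewrite ge_min le_max (ltW hx) (ltW hy) orbT.
    by apply: nex; exists c => //; exact: (oitv_itvcc Ix Iy).
  have [|c cxy hc] := IVT yx (weak_deriv_continuous wh Iy Ix yx) (v := e).
    by rewrite ge_min le_max (ltW hx) (ltW hy) orbT.
  by apply: nex; exists c => //; exact: (oitv_itvcc Iy Ix).
have [x0 Ix0] : exists x, oitv a b x.
  apply: contrapT => noI; apply: (density_not_ae_false dp).
  by apply: aeW => x Ix; apply: noI; exists x.
have i1 := integrable_subM e dp h1.
have mI := measurable_oitv a b; have [_ p0 _] := dp.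
have := Rintegral_centered dp h1; rewrite -/e.
have := hne _ Ix0; rewrite neq_lt => /orP[hx0|hx0].
  have hlt x : oitv a b x -> h x < e.
    move=> Ix; have := hne _ Ix; rewrite neq_lt => /orP[//|hx].
    by exfalso; exact: (crossing x0 x).
  move=> /eqP; rewrite -oppr_eq0 -[- _]mulN1r -RintegralZl//; apply/negP.
  apply: (ae_pos_Rintegral_neq0 dp).
    exact: (integrable_EFinZl _ mI i1).
  apply: lebesgue_aeS p0 => x px Ix; have := px Ix; have := hlt _ Ix; nra.
have hgt x : oitv a b x -> e < h x.
  move=> Ix; have := hne _ Ix; rewrite neq_lt => /orP[hx|//].
  by exfalso; exact: (crossing x x0).
apply/eqP/(ae_pos_Rintegral_neq0 dp) => //.
by apply: lebesgue_aeS p0 => x px Ix; rewrite mulr_gt0 ?subr_gt0 ?hgt ?px.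
Qed.

(** * The primitive of the centred function *)

(** This is [Ttilde] without its factor [(p x)^-1]. *)
Definition centered_primitive (R : realType) (a b : \bar R) (p h : R -> R)
    (x : R) : R :=
  Rintegral lebesgue_measure [set y | (a < y%:E)%E /\ y < x]
    (fun y => (h y - Ep a b p h) * p y).

Section centered_primitive.
Context (R : realType) (a b : \bar R) (p h dh : R -> R) (m : R).
Hypotheses (dp : is_density a b p) (h1 : inL1 a b p h).
Hypotheses (wh : weak_deriv a b h dh).
Hypothesis dh0 : {ae (@lebesgue_measure R), forall x, oitv a b x -> dh x < 0}.
Hypotheses (Im : oitv a b m) (hm : h m = Ep a b p h).
Local Notation I := (oitv a b).
Local Notation e := (Ep a b p h).
Local Notation G := (centered_primitive a b p h).

(** The density is positive only almost everywhere; [|p|] makes the integrand nonnegative at every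
    point, as the Tonelli lemmas ask. *)
Let f (x : R) : \bar R := (`|h x - e| * `|p x|)%:E.

Lemma measurable_density : measurable_fun I p.
Proof.
case: dp => ip _ _; apply/measurable_EFinP.
exact: (measurable_int lebesgue_measure ip).
Qed.

Lemma measurable_centered_abs : measurable_fun I f.
Proof.
apply/measurable_EFinP; apply: measurable_funM.
  apply: measurableT_comp => //; apply: measurable_funB => //; exact: h1.1.
by apply: measurableT_comp => //; exact: measurable_density.
Qed.

(** If [u <= m], the points [x] concerned are those below [u], where [h >= e], and the integral is
    [G u] itself. If [m < u], they are those from [u] on, where [h <= e], and the integral is minus
    that of [g] over [U], which is again [G u]. *)
Lemma integral_between_centered (u : R) : I u ->
  (\int[lebesgue_measure]_(x in I `&` [set x | between m x u])
     (`|h x - e| * `|p x|)%:E = (G u)%:E)%E.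
Proof.
move=> Iu; have mI := measurable_oitv a b; have [_ p0 _] := dp.
pose g y := (h y - e) * p y.
have ig : lebesgue_measure.-integrable I (EFin \o g).
  exact: (integrable_subM e dp h1).
pose L : set R := [set y | (a < y%:E)%E /\ y < u].
pose U : set R := I `&` [set y | u <= y].
have LE : L = I `&` [set y | y < u].
  apply/seteqP; split=> y /= => [[ay yu]|[[ay _] yu]] //; split => //.
  by split => //; rewrite (lt_trans _ Iu.2)// lte_fin.
have mlt : measurable [set y : R | y < u].
  by rewrite (_ : [set _ | _] = `]-oo, u[%classic)// set_itvNyo.
have mge : measurable [set y : R | u <= y].
  by rewrite (_ : [set _ | _] = `[u, +oo[%classic)// set_itvcy.
have mL : measurable L by rewrite LE; exact: measurableI.
have mU : measurable U by exact: measurableI.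
have LI : L `<=` I by rewrite LE; exact: subIsetl.
have UI : U `<=` I by exact: subIsetl.
have iL : lebesgue_measure.-integrable L (EFin \o g) by exact: integrableS ig.
have iU : lebesgue_measure.-integrable U (EFin \o g) by exact: integrableS ig.
(* [L] and [U] split the interval, over which [g] integrates to 0. *)
have gLU : Rintegral lebesgue_measure L g + Rintegral lebesgue_measure U g = 0.
  have LUI : L `|` U = I.
    rewrite LE /U -setIUr; apply/seteqP; split=> y /=; first by case.
    by move=> Iy; split => //; case: (ltP y u); [left|right].
  rewrite -Rintegral_setU//.
  - by rewrite LUI; exact: (Rintegral_centered dp h1).
  - by rewrite LUI.
  - apply/disj_setPS => y []; rewrite LE /U /= => -[_ yu] [_].
    by rewrite leNgt yu.
have [um|mu] := leP u m.
  have -> : I `&` [set x | between m x u] = L.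
    rewrite LE; congr (_ `&` _); apply/seteqP; split=> y /=.
      by case/orP => /andP[? ?]; lra.
    by move=> yu; apply/orP; right; rewrite yu um.
  rewrite [RHS](_ : _ = \int[lebesgue_measure]_(x in L) (g x)%:E)%E; last first.
    by rewrite fineK//; exact: integrable_fin_num.
  apply: ae_eq_integral => //.
  - by apply: measurable_funS measurable_centered_abs.
  - exact: (measurable_int lebesgue_measure iL).
  - apply: lebesgue_aeS p0 => x px Lx; have Ix := LI _ Lx; have {}px := px Ix.
    rewrite /g (gtr0_norm px) ger0_norm// subr_ge0 -hm.
    apply: (weak_deriv_lt0_nincr wh dh0) => //.
    by rewrite (le_trans _ um)// ltW//; case: Lx.
have -> : I `&` [set x | between m x u] = U.
  congr (_ `&` _); apply/seteqP; split=> y /=.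
    by case/orP => /andP[? ?]; lra.
  by move=> uy; apply/orP; left; rewrite mu uy.
have -> : G u = - Rintegral lebesgue_measure U g.
  by apply/eqP; rewrite -addr_eq0 gLU.
rewrite -[- Rintegral _ _ _]mulN1r -[-1 * _]RintegralZl//.
rewrite [in RHS]/Rintegral fineK; last first.
  exact/integrable_fin_num/integrable_EFinZl.
apply: ae_eq_integral => //.
- by apply: measurable_funS measurable_centered_abs.
- exact: (measurable_int lebesgue_measure (integrable_EFinZl _ mU iU)).
- apply: lebesgue_aeS p0 => x px Ux; have Ix := UI _ Ux; have {}px := px Ix.
  rewrite /g (gtr0_norm px) ler0_norm; first by rewrite mulN1r mulNr.
  rewrite subr_le0 -hm; apply: (weak_deriv_lt0_nincr wh dh0) => //.
  by rewrite (le_trans (ltW mu))//; case: Ux.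
Qed.

Lemma centered_primitive_ge0 u : I u -> 0 <= G u.
Proof.
by move=> Iu; rewrite -lee_fin -integral_between_centered//; exact: integral_ge0.
Qed.

(** Extension by 0, because the Tonelli lemmas are stated on the whole line. *)
Let fI := f \_ I.

Let fI0 x : (0 <= fI x)%E.
Proof. by apply: erestrict_ge0 => y _; rewrite lee_fin mulr_ge0. Qed.

Let mfI : measurable_fun setT fI.
Proof.
apply/measurable_restrict => //; first exact: measurable_oitv.
by rewrite setTI; exact: measurable_centered_abs.
Qed.

Let int_fI u : I u ->
  (\int[lebesgue_measure]_(x in [set x | between m x u]) fI x = (G u)%:E)%E.
Proof. by move=> Iu; rewrite -integral_mkcondl integral_between_centered. Qed.

(** With [q] constantly 1, the partial integral in the Tonelli argument is [G] itself on the
    interval. *)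
Lemma measurable_centered_primitive : measurable_fun I G.
Proof.
apply/measurable_EFinP.
have := @measurable_mul_integral_between_inv _ m fI (cst 1%E) mfI
  (measurable_cst _) fI0 (fun=> lee01).
move=> /(measurable_funS measurableT (@subsetT _ I)).
apply: eq_measurable_fun => u /set_mem Iu.
by rewrite /= mul1e int_fI.
Qed.

Section weight.
Context (q : R -> \bar R).
Hypotheses (mq : measurable_fun I q) (q0 : forall x, (0 <= q x)%E).

Let qI := q \_ I.

Let qI0 x : (0 <= qI x)%E. Proof. exact: erestrict_ge0. Qed.

Let mqI : measurable_fun setT qI.
Proof.
apply/measurable_restrict => //; first exact: measurable_oitv.
by rewrite setTI.
Qed.

Let int_qI x : I x ->
  (\int[lebesgue_measure]_(u in between m x) qI u =
   \int[lebesgue_measure]_(u in between m x) q u)%E.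
Proof.
move=> Ix; apply: eq_integral => u /set_mem /(between_oitv Im Ix) Iu.
by rewrite /qI patchE mem_set.
Qed.

Lemma measurable_centered_mul_integral_between :
  measurable_fun I (fun x => (`|h x - e| * `|p x|)%:E *
    \int[lebesgue_measure]_(u in between m x) q u)%E.
Proof.
have := measurable_mul_integral_between m mfI mqI fI0 qI0.
move=> /(measurable_funS measurableT (@subsetT _ I)).
apply: eq_measurable_fun => x /set_mem Ix.
by rewrite int_qI// /fI patchE mem_set.
Qed.

(* Interchanging the integrals turns the mass beyond u into the primitive at u,
   on either side of the point m where h attains its mean. *)
Lemma tonelli_centered :
  (\int[lebesgue_measure]_(x in I) ((`|h x - e| * `|p x|)%:E *
     \int[lebesgue_measure]_(u in between m x) q u) =
   \int[lebesgue_measure]_(u in I) (q u * (G u)%:E))%E.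
Proof.
have := tonelli_between m mfI mqI fI0 qI0.
rewrite (_ : \int[lebesgue_measure]_x _ = \int[lebesgue_measure]_(x in I)
    ((`|h x - e| * `|p x|)%:E *
     \int[lebesgue_measure]_(u in between m x) q u))%E; last first.
  rewrite [RHS]integral_mkcond; apply: eq_integral => x _; rewrite /fI !patchE.
  by case: ifPn => [/set_mem Ix|_]; rewrite ?mul0e// int_qI.
move=> ->; rewrite [RHS]integral_mkcond; apply: eq_integral => u _.
rewrite /qI !patchE.
by case: ifPn => [/set_mem Iu|_]; rewrite ?mul0e// int_fI.
Qed.

End weight.

End centered_primitive.

(** * Cauchy-Schwarz for increments *)

Lemma ge0_integral_EFinZl (R : realType) (D : set R) (c : R) (f : R -> R) :
  measurable D -> measurable_fun D f -> 0 <= c -> (forall x, 0 <= f x) ->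
  (\int[lebesgue_measure]_(x in D) (c * f x)%:E =
   c%:E * \int[lebesgue_measure]_(x in D) (f x)%:E)%E.
Proof.
move=> mD mf c0 f0; under eq_integral do rewrite EFinM.
rewrite ge0_integralZl_EFin//; last exact/measurable_EFinP.
by move=> x _; rewrite lee_fin.
Qed.

(** Recovers a product bound from a family of additive bounds, without square roots and allowing [Q]
    to be infinite. *)
Lemma le_mul_of_amgm (R : realType) (D L : R) (Q : \bar R) :
  0 <= D -> 0 < L -> (0 <= Q)%E ->
  (forall t : R, (0 < t)%R -> (2 * D)%:E <= t%:E * Q + (t^-1 * L)%:E)%E ->
  ((D ^+ 2)%:E <= L%:E * Q)%E.
Proof.
move=> D0 L0 Q0 amgm.
have [->|/eqP DN0] := eqVneq D 0; first by rewrite expr0n/= mule_ge0// lee_fin ltW.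
have {DN0}Dp : 0 < D by rewrite lt_neqAle D0 andbT eq_sym; apply/eqP.
case: Q Q0 amgm => [Q Q0 amgm|_ _|//]; last first.
  by rewrite gt0_muley ?lte_fin// leey.
(* This [t] makes the second term equal to [D], leaving [D <= (L / D) * Q]. *)
have := amgm (L / D) (divr_gt0 L0 Dp); rewrite -EFinM -EFinD -EFinM !lee_fin.
have -> : (L / D)^-1 * L = D by field; rewrite !gt_eqF.
rewrite [2 * D]mulrDl !mul1r lerD2r => DQ.
have := ler_wpM2r D0 DQ; rewrite -expr2 mulrAC divfK ?gt_eqF//.
Qed.

(** The right side minus the left side is [(t |x| - |y|) ^+ 2 / (t |y|)]. *)
Lemma amgm_sqr_div (R : realType) (t x y : R) : 0 < t -> y != 0 ->
  2 * `|x| <= t * (x ^+ 2 * `|y|^-1) + t^-1 * `|y|.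
Proof.
move=> t0; rewrite -normr_gt0 => y0.
rewrite -subr_ge0 -[x ^+ 2]real_normK ?num_real//.
move: `|x| `|y| y0 => {}x {}y y0.
have -> : t * (x ^+ 2 * y^-1) + t^-1 * y - 2 * x = (t * x - y) ^+ 2 / (t * y).
  by field; rewrite !gt_eqF.
by rewrite divr_ge0 ?sqr_ge0// mulr_ge0// ltW.
Qed.

Section weak_cauchy_schwarz.
Context (R : realType) (a b : \bar R) (h1 dh1 h dh : R -> R) (m x : R).
Hypotheses (wh1 : weak_deriv a b h1 dh1) (wh : weak_deriv a b h dh).
Hypothesis dh10 :
  {ae (@lebesgue_measure R), forall x, oitv a b x -> dh1 x < 0}.
Hypotheses (Im : oitv a b m) (Ix : oitv a b x).

(** Integrating [amgm_sqr_div] with [x = dh u] and [y = dh1 u] bounds [2 |h x - h m|] for each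
    [t > 0], because [|dh1|] integrates exactly to [|h1 x - h1 m|]; [le_mul_of_amgm] then eliminates
    [t]. *)
Lemma weak_deriv_cauchy_schwarz :
  (((h x - h m) ^+ 2)%:E <= `|h1 x - h1 m|%:E *
   \int[lebesgue_measure]_(u in between m x) (dh u ^+ 2 * `|dh1 u|^-1)%:E)%E.
Proof.
have mB := measurable_between m x.
have mdh := weak_deriv_measurable_between wh Im Ix.
have mdh1 := weak_deriv_measurable_between wh1 Im Ix.
have dh1B : {ae (@lebesgue_measure R), forall u, between m x u -> dh1 u < 0}.
  by apply: lebesgue_aeS dh10 => u du /(between_oitv Im Ix).
have mq : measurable_fun (between m x) (fun u => (dh u ^+ 2 * `|dh1 u|^-1)).
  by apply: measurable_funM; [exact: measurable_funX|exact: measurable_funVnorm].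
rewrite -[(h x - h m) ^+ 2]real_normK ?num_real//.
(* Degenerate case: [|dh1|] integrates to 0 while [dh1 < 0] almost everywhere, so the set between
   [m] and [x] is null and [h] does not move either. *)
have [L0|LN0] := eqVneq (h1 x - h1 m) 0.
  suff -> : `|h x - h m| = 0.
    rewrite expr0n/= mule_ge0//; apply: integral_ge0 => u _.
    by rewrite lee_fin mulr_ge0 ?sqr_ge0// invr_ge0.
  apply/eqP; rewrite eq_le normr_ge0 andbT -lee_fin.
  apply: (le_trans (weak_deriv_dist_le wh Im Ix)).
  have emptyB : {ae (@lebesgue_measure R), forall u, between m x u -> False}.
    have := weak_deriv_lt0_dist wh1 dh10 Im Ix; rewrite L0 normr0 => /esym L00.
    have : ae_eq lebesgue_measure (between m x) (EFin \o dh1) (cst 0%E).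
      apply/ae_eq_integral_abs => //; exact/measurable_EFinP.
    apply: lebesgue_aeS2 dh1B => u du0 du1 Bu.
    by move: (du0 Bu) (du1 Bu) => /= /[swap] -[->]; rewrite ltxx.
  rewrite (ae_eq_integral (cst 0%E))// ?integral0//.
  - by apply/measurable_EFinP; exact: measurableT_comp.
  - by apply: lebesgue_aeS emptyB => u Bu /Bu.
apply: le_mul_of_amgm => //; first by rewrite normr_gt0.
  apply: integral_ge0 => u _.
  by rewrite lee_fin mulr_ge0 ?sqr_ge0// invr_ge0.
move=> t t0; rewrite [(t^-1 * _)%:E]EFinM (weak_deriv_lt0_dist wh1 dh10 Im Ix)//.
have t10 : 0 <= t^-1 by rewrite invr_ge0 ltW.
apply: (@le_trans _ _
    (2%:E * \int[lebesgue_measure]_(u in between m x) `|dh u|%:E)%E).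
  by rewrite EFinM lee_wpmul2l ?lee_fin//; exact: (weak_deriv_dist_le wh).
have mdhn : measurable_fun (between m x) (fun u => `|dh u|).
  exact: measurableT_comp.
have mdh1n : measurable_fun (between m x) (fun u => `|dh1 u|).
  exact: measurableT_comp.
have q0 u : 0 <= dh u ^+ 2 * `|dh1 u|^-1.
  by rewrite mulr_ge0 ?sqr_ge0// invr_ge0.
rewrite -!ge0_integral_EFinZl// ?(ltW t0)// -ge0_integralD//; last 4 first.
- by move=> u _; rewrite lee_fin mulr_ge0// ltW.
- by apply/measurable_EFinP; exact: measurable_funM.
- by move=> u _; rewrite lee_fin mulr_ge0.
- by apply/measurable_EFinP; exact: measurable_funM.
apply: ae_ge0_le_integral => //.
- by apply/measurable_EFinP; exact: measurable_funM.
- move=> u _; rewrite -EFinD lee_fin.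
  by apply: addr_ge0; apply: mulr_ge0 => //; exact: ltW.
- by apply: emeasurable_funD; apply/measurable_EFinP; exact: measurable_funM.
- apply: lebesgue_aeS dh1B => u du Bu; rewrite -EFinD lee_fin.
  by apply: amgm_sqr_div => //; rewrite lt_eqF ?du.
Qed.

End weak_cauchy_schwarz.

(** * Comparison of variance and energy *)

Section poincare_bounds.
Context (R : realType) (a b : \bar R) (p w k dk : R -> R).
Hypotheses (dp : is_density a b p) (ww : is_weight a b p w).
Hypotheses (k1 : inL1 a b p k) (wk : weak_deriv a b k dk).
Hypothesis dk0 : {ae (@lebesgue_measure R), forall x, oitv a b x -> dk x < 0}.
Local Notation I := (oitv a b).
Local Notation G := (centered_primitive a b p k).
Local Notation mu := (@lebesgue_measure R).

Let mI := measurable_oitv a b.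
Let mp := measurable_density dp.
Let mdk := weak_deriv_measurable wk.

Let mw : measurable_fun I w.
Proof. by case: ww => /locint_measurable. Qed.

Let mG : measurable_fun I G.
Proof.
have [m Im km] := ex_eq_mean dp k1 wk.
exact: (measurable_centered_primitive dp k1 wk dk0 Im km).
Qed.

Let ae_sign :
  {ae mu, forall x, I x -> [/\ 0 < p x, 0 < w x & dk x < 0]}.
Proof.
have [_ p0 _] := dp; have [_ w0 _] := ww.
have pw := lebesgue_aeS2 (fun x => @conj _ _) p0 w0.
apply: (lebesgue_aeS2 _ pw dk0) => x [px wx] dx Ix.
by split; [exact: px|exact: wx|exact: dx].
Qed.

(** Writes [G] as the ratio of the theorem times a positive factor, so that bounds on the ratio turn
    into bounds on [G] and conversely. *)
Lemma ae_primitive_ratio :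
  {ae mu, forall x, I x -> 0 < `|dk x| * p x * w x /\
    G x = - (Ttilde a b p k x / (dk x * w x)) * (`|dk x| * p x * w x)}.
Proof.
apply: lebesgue_aeS ae_sign => x + Ix => /(_ Ix)[px wx dx].
split; first by rewrite !mulr_gt0// normr_gt0 lt_eqF.
rewrite (ltr0_norm dx) /Ttilde -/(centered_primitive a b p k x).
by field; rewrite (lt_eqF dx) !gt_eqF.
Qed.

Lemma energy_abs (dh : R -> R) : measurable_fun I dh ->
  energy a b p w dh = (\int[mu]_(x in I) (dh x ^+ 2 * `|p x| * `|w x|)%:E)%E.
Proof.
move=> mdh; have [_ p0 _] := dp; have [_ w0 _] := ww.
apply: ae_eq_integral => //.
- apply/measurable_EFinP; apply: measurable_funM => //.
  by apply: measurable_funM => //; exact: measurable_funX.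
- apply/measurable_EFinP; apply: measurable_funM; last exact: measurableT_comp.
  by apply: measurable_funM; [exact: measurable_funX|exact: measurableT_comp].
- apply: lebesgue_aeS2 p0 w0 => x px wx Ix.
  by rewrite !gtr0_norm ?px ?wx.
Qed.

(** In [tonelli_centered] with [q = |dk|] the inner integral is exactly [|k x - k m|], and [k m] is
    the mean. Both sides may be infinite, as [k] is only in L1. *)
Lemma Varp_primitive :
  Varp a b p k = (\int[mu]_(x in I) (`|dk x| * G x)%:E)%E.
Proof.
have [m Im km] := ex_eq_mean dp k1 wk; have [_ p0 _] := dp.
have mabs : measurable_fun I (fun x => `|dk x|%:E).
  by apply/measurable_EFinP; exact: measurableT_comp.
transitivity (\int[mu]_(x in I) ((`|k x - Ep a b p k| * `|p x|)%:E *
    \int[mu]_(u in between m x) `|dk u|%:E))%E; last first.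
  by rewrite (tonelli_centered dp k1 wk dk0 Im km mabs).
apply: ae_eq_integral => //.
- apply/measurable_EFinP; apply: measurable_funM => //; apply: measurable_funX.
  by apply: measurable_funB => //; exact: k1.1.
- exact: (measurable_centered_mul_integral_between dp k1 Im mabs).
- apply: lebesgue_aeS p0 => x px Ix.
  rewrite -(weak_deriv_lt0_dist wk dk0 Im Ix) km -EFinM; congr EFin.
  rewrite (gtr0_norm (px Ix)) [RHS]mulrAC -[X in _ = X * _]expr2.
  by rewrite real_normK ?num_real.
Qed.

(** Multiplying the assumed bound by [|dk|] and integrating gives the energy on the left and, by
    [Varp_primitive], the variance on the right. *)
Lemma Varp_ge_energy (c : R) : 0 <= c ->
  {ae mu, forall x, I x -> c * (`|dk x| * p x * w x) <= G x} ->
  (c%:E * energy a b p w dk <= Varp a b p k)%E.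
Proof.
move=> c0 cG.
have m2 : measurable_fun I (fun x => dk x ^+ 2 * `|p x| * `|w x|).
  apply: measurable_funM; last exact: measurableT_comp.
  by apply: measurable_funM; [exact: measurable_funX|exact: measurableT_comp].
rewrite energy_abs// Varp_primitive -ge0_integral_EFinZl//; last first.
  by move=> x; rewrite mulr_ge0// mulr_ge0// sqr_ge0.
have [m Im km] := ex_eq_mean dp k1 wk.
apply: ae_ge0_le_integral => //.
- by move=> x _; rewrite lee_fin mulr_ge0// mulr_ge0// mulr_ge0// sqr_ge0.
- by apply/measurable_EFinP; exact: measurable_funM.
- move=> x Ix; rewrite lee_fin mulr_ge0//.
  exact: (centered_primitive_ge0 dp k1 wk dk0 Im km).
- apply/measurable_EFinP; apply: measurable_funM => //.
  exact: measurableT_comp.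
apply: (lebesgue_aeS2 _ cG ae_sign) => x + + Ix => /(_ Ix) cGx /(_ Ix)[px wx _].
rewrite lee_fin (gtr0_norm px) (gtr0_norm wx).
apply: le_trans (ler_wpM2l (normr_ge0 (dk x)) cGx).
rewrite -[dk x ^+ 2]real_normK ?num_real// le_eqVlt.
by apply/orP; left; apply/eqP; ring.
Qed.

Lemma Varp_eq_energy (c : R) : 0 <= c ->
  {ae mu, forall x, I x -> G x = c * (`|dk x| * p x * w x)} ->
  Varp a b p k = (c%:E * energy a b p w dk)%E.
Proof.
move=> c0 Gc; have mpn : measurable_fun I (fun x => `|p x|).
  exact: measurableT_comp.
have mwn : measurable_fun I (fun x => `|w x|) by exact: measurableT_comp.
have m2 : measurable_fun I (fun x => dk x ^+ 2 * `|p x| * `|w x|).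
  by do 2 apply: measurable_funM => //; exact: measurable_funX.
rewrite energy_abs// Varp_primitive -ge0_integral_EFinZl//; last first.
  by move=> x; rewrite mulr_ge0// mulr_ge0// sqr_ge0.
apply: ae_eq_integral => //.
- apply/measurable_EFinP; apply: measurable_funM => //.
  exact: measurableT_comp.
- by apply/measurable_EFinP; exact: measurable_funM.
apply: (lebesgue_aeS2 _ Gc ae_sign) => x + + Ix => /(_ Ix) -> /(_ Ix)[px wx _].
rewrite (gtr0_norm px) (gtr0_norm wx) -[dk x ^+ 2]real_normK ?num_real//.
by congr EFin; ring.
Qed.

(** A zero energy would make its integrand, positive almost everywhere, vanish almost everywhere.
    Positivity allows the energy to be cancelled in the lower bound. *)
Lemma energy_gt0 : (0 < energy a b p w dk)%E.
Proof.
rewrite energy_abs//; set f := fun x : R => dk x ^+ 2 * `|p x| * `|w x|.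
have f0 x : 0 <= f x by rewrite mulr_ge0// mulr_ge0// sqr_ge0.
have mpn : measurable_fun I (fun x => `|p x|) by exact: measurableT_comp.
have mwn : measurable_fun I (fun x => `|w x|) by exact: measurableT_comp.
have mf : measurable_fun I f.
  by do 2 apply: measurable_funM => //; exact: measurable_funX.
rewrite lt_neqAle andbC; apply/andP; split.
  by apply: integral_ge0 => x _; rewrite lee_fin; exact: f0.
apply/eqP => /esym fI0; apply: (density_not_ae_false dp).
have : ae_eq mu I (EFin \o f) (cst 0%E).
  apply/ae_eq_integral_abs => //; first exact/measurable_EFinP.
  rewrite -[RHS]fI0; apply: eq_integral => x _.
  by rewrite gee0_abs// lee_fin; exact: f0.
apply: (lebesgue_aeS2 _ ae_sign) => x + + Ix => /(_ Ix)[px wx dx] /(_ Ix) [].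
move=> fx0; have : 0 < f x; last by rewrite fx0 ltxx.
rewrite /f (gtr0_norm px) (gtr0_norm wx) -[dk x ^+ 2]real_normK ?num_real//.
by rewrite mulr_gt0// mulr_gt0// exprn_gt0// normr_gt0 lt_eqF.
Qed.

Lemma inH1_of_energy_lty : inL2 a b p k -> (energy a b p w dk < +oo)%E ->
  inH1 a b p w k dk.
Proof.
move=> k2 Ey; split => //; apply/integrableP; split.
  apply/measurable_EFinP; apply: measurable_funM => //.
  by apply: measurable_funM => //; exact: measurable_funX.
rewrite energy_abs// in Ey; apply: le_lt_trans Ey.
rewrite le_eqVlt; apply/orP; left; apply/eqP; apply: eq_integral => x _ /=.
by rewrite normrM normrM (ger0_norm (sqr_ge0 (dk x))).
Qed.

(** Here [k] is the fixed reference function and [h] the arbitrary competitor: Cauchy-Schwarz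
    relative to [k], then Tonelli with [q = dh ^+ 2 / |dk|], then the bound on [G]. *)
Lemma Varp_le_energy (c : R) : 0 <= c ->
  {ae mu, forall x, I x -> G x <= c * (`|dk x| * p x * w x)} ->
  forall h dh, inH1 a b p w h dh ->
  (Varp a b p h <= c%:E * energy a b p w dh)%E.
Proof.
move=> c0 Gc h dh [h2 wh ieh]; have [_ p0 _] := dp.
have [m Im km] := ex_eq_mean dp k1 wk.
have mdh := weak_deriv_measurable wh.
pose q u := dh u ^+ 2 * `|dk u|^-1.
have q0 u : 0 <= q u by rewrite mulr_ge0 ?sqr_ge0// invr_ge0.
have mq : measurable_fun I q.
  by apply: measurable_funM; [exact: measurable_funX|exact: measurable_funVnorm].
have mqE : measurable_fun I (fun u => (q u)%:E) by exact/measurable_EFinP.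
have mhm : measurable_fun I (fun x => (h x - h m) ^+ 2).
  by apply: measurable_funX; apply: measurable_funB => //; exact: h2.1.
have mpn : measurable_fun I (fun x => `|p x|) by exact: measurableT_comp.
have mwn : measurable_fun I (fun x => `|w x|) by exact: measurableT_comp.
(* The point [m] is where [k], not [h], attains its mean, so [h m] replaces the mean of [h] at the
   cost of an inequality. *)
apply: (le_trans (Varp_le (h m) dp h2)).
have -> : (\int[mu]_(x in I) ((h x - h m) ^+ 2 * p x)%:E =
    \int[mu]_(x in I) ((h x - h m) ^+ 2 * `|p x|)%:E)%E.
  apply: ae_eq_integral => //.
  - by apply/measurable_EFinP; exact: measurable_funM.
  - by apply/measurable_EFinP; exact: measurable_funM.
  - by apply: lebesgue_aeS p0 => x px Ix; rewrite (gtr0_norm (px Ix)).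
apply: (@le_trans _ _ (\int[mu]_(x in I) ((`|k x - Ep a b p k| * `|p x|)%:E *
    \int[mu]_(u in between m x) (q u)%:E))%E).
  apply: ge0_le_integral => //.
  - by move=> x _; rewrite lee_fin mulr_ge0// sqr_ge0.
  - by apply/measurable_EFinP; exact: measurable_funM.
  - exact: (measurable_centered_mul_integral_between dp k1 Im mqE).
  move=> x Ix; rewrite !(mulrC _ `|p x|) !EFinM -muleA lee_wpmul2l ?lee_fin//.
  by rewrite -km; exact: (weak_deriv_cauchy_schwarz wk wh dk0 Im Ix).
rewrite (tonelli_centered dp k1 wk dk0 Im km mqE)// energy_abs//.
have m2 : measurable_fun I (fun x => dh x ^+ 2 * `|p x| * `|w x|).
  by do 2 apply: measurable_funM => //; exact: measurable_funX.
rewrite -ge0_integral_EFinZl//; last first.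
  by move=> x; rewrite mulr_ge0// mulr_ge0// sqr_ge0.
apply: ae_ge0_le_integral => //.
- move=> x Ix; rewrite -EFinM lee_fin mulr_ge0//.
  exact: (centered_primitive_ge0 dp k1 wk dk0 Im km).
- by apply/measurable_EFinP; exact: measurable_funM.
- by move=> x _; rewrite lee_fin mulr_ge0// mulr_ge0// mulr_ge0// sqr_ge0.
- by apply/measurable_EFinP; exact: measurable_funM.
apply: (lebesgue_aeS2 _ Gc ae_sign) => x + + Ix => /(_ Ix) Gx /(_ Ix)[px wx dx].
rewrite -EFinM lee_fin (gtr0_norm px) (gtr0_norm wx).
(* The factor [|dk|] in the bound on [G] cancels the denominator of [q], leaving [c] times the
   energy density of [h]. *)
apply: (le_trans (ler_wpM2l (q0 x) Gx)); rewrite /q.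
have dkx : `|dk x| != 0 by rewrite normr_eq0 lt_eqF.
by rewrite le_eqVlt; apply/orP; left; apply/eqP; field.
Qed.

End poincare_bounds.

(** * Bounds on the Poincaré constant *)

Section poincare_const.
Context (R : realType) (a b : \bar R) (p w k dk : R -> R).
Hypotheses (dp : is_density a b p) (ww : is_weight a b p w).
Hypotheses (k1 : inL1 a b p k) (wk : weak_deriv a b k dk).
Hypothesis dk0 : {ae (@lebesgue_measure R), forall x, oitv a b x -> dk x < 0}.
Local Notation ratio := (fun x => - (Ttilde a b p k x / (dk x * w x))).

Lemma ae_ratio_ge0 :
  {ae (@lebesgue_measure R), forall x, oitv a b x -> 0 <= ratio x}.
Proof.
have [m Im km] := ex_eq_mean dp k1 wk.
apply: lebesgue_aeS (ae_primitive_ratio k dp ww dk0) => x + Ix.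
move=> /(_ Ix)[d0 GE].
have := centered_primitive_ge0 dp k1 wk dk0 Im km Ix.
by rewrite GE pmulr_lge0.
Qed.

(** Every finite essential upper bound of the ratio is an admissible constant, by
    [Varp_le_energy]. *)
Lemma poincare_const_le_ess_sup :
  (poincare_const a b p w <= ess_sup_on a b ratio)%E.
Proof.
apply: le_ereal_inf_tmp => -[c Fc||Fc]; last 2 first.
- by rewrite leey.
- exfalso; apply: (density_not_ae_false dp).
  by apply: lebesgue_aeS Fc => x + Ix => /(_ Ix); rewrite leeNy_eq.
(* Admissible constants have to be nonnegative; the ratio is nonnegative almost everywhere on a set
   that is not null. *)
have c0 : 0 <= c.
  rewrite leNgt; apply/negP => c0; apply: (density_not_ae_false dp).
  apply: (lebesgue_aeS2 _ ae_ratio_ge0 Fc) => x + + Ix => /(_ Ix) F0 /(_ Ix).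
  by rewrite lee_fin leNgt (lt_le_trans c0).
apply: ereal_inf_lbound; split; first by rewrite lee_fin.
apply: (Varp_le_energy dp ww k1 wk dk0 c0).
apply: (lebesgue_aeS2 _ (ae_primitive_ratio k dp ww dk0) Fc) => x + + Ix.
move=> /(_ Ix)[d0 ->] /(_ Ix); rewrite lee_fin => Fx.
by rewrite ler_wpM2r// ltW.
Qed.

(** Testing an admissible [C] on [k] itself gives [c * energy <= Var <= C * energy] for an essential
    lower bound [c > 0], and the energy, positive and finite, is cancelled. *)
Lemma ess_inf_le_poincare_const : inL2 a b p k ->
  (ess_inf_on a b ratio <= poincare_const a b p w)%E.
Proof.
move=> k2; apply: ge_ereal_sup => c Fc; apply: le_ereal_inf_tmp => C [C0 PC].
case: c Fc => [c Fc|Fc|_]; last by rewrite leNye.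
- have [c0|c0] := leP c 0; first by rewrite (le_trans _ C0)// lee_fin.
  have cE : (c%:E * energy a b p w dk <= Varp a b p k)%E.
    apply: (Varp_ge_energy dp ww k1 wk dk0 (ltW c0)).
    apply: (lebesgue_aeS2 _ (ae_primitive_ratio k dp ww dk0) Fc) => x + + Ix.
    move=> /(_ Ix)[d0 ->] /(_ Ix); rewrite lee_fin => Fx.
    by rewrite ler_wpM2r// ltW.
  have Vy : (Varp a b p k < +oo)%E.
    apply: integrable_lty; first exact: measurable_oitv.
    exact: (integrable_sqr_subM _ dp k2).
  have E0 := energy_gt0 dp ww wk dk0.
  (* The variance is finite because [k] is in L2, and it dominates a positive multiple of the
     energy; hence [k] is in H1 and may be used as a test function. *)
  have Ey : (energy a b p w dk < +oo)%E.
    rewrite ltey; apply/eqP => Ey; move: (le_lt_trans cE Vy).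
    by rewrite Ey gt0_muley ?lte_fin.
  rewrite -(@lee_pmul2r _ (energy a b p w dk)) ?ge0_fin_numE ?(ltW E0)//.
  apply: (le_trans cE); apply: PC.
  exact: (inH1_of_energy_lty dp ww wk k2 Ey).
- exfalso; apply: (density_not_ae_false dp).
  by apply: lebesgue_aeS Fc => x + Ix => /(_ Ix); rewrite leye_eq.
Qed.

Lemma Varp_ratio_cst (c : R) :
  {ae (@lebesgue_measure R), forall x, oitv a b x -> ratio x = c} ->
  Varp a b p k = (c%:E * energy a b p w dk)%E.
Proof.
move=> Fc; apply: (Varp_eq_energy dp ww k1 wk dk0).
  rewrite leNgt; apply/negP => c0; apply: (density_not_ae_false dp).
  apply: (lebesgue_aeS2 _ ae_ratio_ge0 Fc) => x + + Ix => /(_ Ix) F0 /(_ Ix) Fx.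
  by move: F0; rewrite Fx leNgt c0.
apply: (lebesgue_aeS2 _ (ae_primitive_ratio k dp ww dk0) Fc) => x + + Ix.
by move=> /(_ Ix)[_ GE] /(_ Ix) Fx; rewrite GE Fx.
Qed.

End poincare_const.

Theorem theorem3p1 (R : realType) (a b : \bar R) (p w h1 dh1 h2 dh2 : R -> R) :
  (a < b)%E ->
  is_density a b p ->
  is_weight a b p w ->
  inL1 a b p h1 -> weak_deriv a b h1 dh1 ->
  {ae (@lebesgue_measure R), forall x, oitv a b x -> dh1 x < 0} ->
  inL2 a b p h2 -> weak_deriv a b h2 dh2 ->
  {ae (@lebesgue_measure R), forall x, oitv a b x -> dh2 x < 0} ->
  [/\ (ess_inf_on a b (fun x => (- (Ttilde a b p h2 x / (dh2 x * w x)))%R)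
         <= poincare_const a b p w)%E,
      (poincare_const a b p w
         <= ess_sup_on a b (fun x => (- (Ttilde a b p h1 x / (dh1 x * w x)))%R))%E &
      ((exists c : R, {ae (@lebesgue_measure R), forall x, oitv a b x ->
           - (Ttilde a b p h2 x / (dh2 x * w x)) = c}) ->
       Varp a b p h2 = (poincare_const a b p w * energy a b p w dh2)%E)].
Proof.
move=> _ dp ww h11 wh1 dh10 h22 wh2 dh20; have h21 := inL2_inL1 dp h22; split.
- exact: (ess_inf_le_poincare_const dp ww h21 wh2 dh20 h22).
- exact: (poincare_const_le_ess_sup dp ww h11 wh1 dh10).
(* It remains to identify [c] with the Poincaré constant. Both bounds are applied to [h2], which is
   also in L1; the constant ratio makes [c] an essential lower and upper bound at once. *)
move=> [c Fc]; rewrite (Varp_ratio_cst dp ww h21 wh2 dh20 Fc); congr (_ * _)%E.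
apply/eqP; rewrite eq_le; apply/andP; split.
- apply: le_trans (ess_inf_le_poincare_const dp ww h21 wh2 dh20 h22).
  by apply: ereal_sup_ubound; apply: lebesgue_aeS Fc => x + Ix => /(_ Ix) ->.
- apply: (le_trans (poincare_const_le_ess_sup dp ww h21 wh2 dh20)).
  by apply: ereal_inf_lbound; apply: lebesgue_aeS Fc => x + Ix => /(_ Ix) ->.
Qed.
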